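(* Consider the scalar system $x_{k+1}=Ax_k+w_k$, $k=0,1,\dots$, with $A\ge 0$, $x_0\in[\underline X_0,\overline X_0]$ and $w_k\in[-W/2,W/2]$. Its state is sampled every $T$ steps, quantized to $r$ bits and communicated with latency $d\le T$ and message failure probability $p_e$ with perfect acknowledgments, using the sequential quantization and estimation scheme described in the context. Then the expected value of the estimation error $|x_{\ell T+d}-\hat x_{\ell T+d}|$, $\ell=0,1,\dots$, is bounded if and only if $$\Big(p_e+\frac{1-p_e}{2^r}\Big)A^T<1 .$$
   Context: **System.** $A\ge 0$ and $W>0$ are real numbers. $x_k\in\mathbb R$ evolves by $x_{k+1}=Ax_k+w_k$, where $x_0$ is an unknown element of the known interval $[\underline X_0,\overline X_0]\subset\mathbb R$ and $(w_k)_{k\ge0}$ is an unknown sequence with $w_k\in[-W/2,W/2]$. $A^T$ denotes the $T$-th power of $A$. The symbol $\frac{A^m-1}{A-1}$ means $\sum_{j=0}^{m-1}A^j$ (so it equals $m$ if $A=1$). **Communication model.** $T\ge1$, $r\ge 1$ and $0\le d\le T$ are integers and $p_e\in[0,1]$. For each $\ell=0,1,2,\dots$ the sensor samples $x_{\ell T}$ and sends an $r$-bit message about it, which requires a delay of $d$ time steps. At time $\ell T+d$ the message is either successfully decoded (probability $1-p_e$) or corrupted and discarded (probability $p_e$). The estimator knows which of the two occurred. Success/failure events of different messages are independent, and they do not depend on the state and disturbance. The estimator sends perfect acknowledgments to the sensor, so both sides know which messages were received. **Quantization and estimation scheme.** Sensor and estimator maintain an interval $[L_\ell,U_\ell]$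 guaranteed to contain $x_{\ell T}$ before the $\ell$-th message is sent, with $[L_0,U_0]=[\underline X_0,\overline X_0]$. The sensor divides $[L_\ell,U_\ell]$ uniformly into $2^r$ (closed) bins of equal length and sends the index of a bin containing $x_{\ell T}$. - If the message fails, set $[L'_\ell,U'_\ell]=[L_\ell,U_\ell]$. - If the message succeeds, let $[L'_\ell,U'_\ell]$ be the transmitted bin, of length $(U_\ell-L_\ell)/2^r$. The estimates are $\hat x_{\ell T}=(L'_\ell+U'_\ell)/2$ and $\hat x_{\ell T+d}=A^d\hat x_{\ell T}$. The next interval is $$[L_{\ell+1},U_{\ell+1}]=\Big[A^TL'_\ell-\tfrac{A^T-1}{A-1}\tfrac W2,\;A^TU'_\ell+\tfrac{A^T-1}{A-1}\tfrac W2\Big].$$ **Meaning of boundedness.** The expectation $\mathbb E$ is over the random decoding successes/failures. ''The expected estimation error is bounded'' means that there is a finite constant $C$ such that $\mathbb E|x_{\ell T+d}-\hat x_{\ell T+d}|\le C$ for all $\ell\ge 0$, all $x_0\in[\underline X_0,\overline X_0]$ and all disturbance sequences with $w_k\in[-W/2,W/2]$. *)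

(* Defs.v *)
From HB Require Import structures.
From mathcomp Require Import all_boot all_order all_algebra.
From mathcomp Require Import all_classical all_reals all_analysis.

Set Implicit Arguments.
Unset Strict Implicit.
Unset Printing Implicit Defensive.

Import Order.TTheory GRing.Theory Num.Theory.

Local Open Scope classical_set_scope.
Local Open Scope ring_scope.

(* Intervals [L, U] are pairs (L, U). *)
Definition in_segment (R : realType) (I : R * R) (x : R) : bool := I.1 <= x <= I.2.

Definition midpoint (R : realType) (I : R * R) : R := (I.1 + I.2) / 2.

Fixpoint state (R : realType) (A : R) (x0 : R) (w : nat -> R) (k : nat) : R :=
  if k is k'.+1 then A * state A x0 w k' + w k' else x0.

(* (A ^ m - 1) / (A - 1), extended by m at A = 1. *)
Definition geom_sum (R : realType) (A : R) (m : nat) : R :=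
  \sum_(j < m) A ^+ j.

Definition bin (R : realType) (r : nat) (I : R * R) (i : 'I_(2 ^ r)) : R * R :=
  let h := (I.2 - I.1) / 2 ^+ r in
  (I.1 + i%:R * h, I.1 + i.+1%:R * h).

(* Neighbouring closed bins share an endpoint, so the transmitted index is not
   determined by the interval and the sample. An encoder is any tie-breaking
   rule; it may use the acknowledgments of the previous messages (first
   argument, true = received), whose number is the index of the message. *)
Definition encoder (R : realType) (r : nat) :=
  seq bool -> R * R -> R -> 'I_(2 ^ r).

Definition valid_encoder (R : realType) (r : nat) (enc : encoder R r) : Prop :=
  forall (h : seq bool) (I : R * R) (x : R),
    in_segment I x -> in_segment (bin I (enc h I x)) x.

Definition update (R : realType) (r : nat) (enc : encoder R r)
    (ok : bool) (h : seq bool) (I : R * R) (x : R) : R * R :=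
  if ok then bin I (enc h I x) else I.

Definition predict (R : realType) (A W : R) (T : nat) (I : R * R) : R * R :=
  (A ^+ T * I.1 - geom_sum A T * (W / 2),
   A ^+ T * I.2 + geom_sum A T * (W / 2)).

(* [L_l, U_l]; x is the state trajectory and s l tells whether message l is
   successfully decoded. *)
Fixpoint prior (R : realType) (A W : R) (T r : nat) (enc : encoder R r)
    (X0 : R * R) (x : nat -> R) (s : nat -> bool) (l : nat) : R * R :=
  if l is k.+1 then
    predict A W T (update enc (s k) (mkseq s k)
      (prior A W T enc X0 x s k) (x (k * T)%N))
  else X0.

(* [L'_l, U'_l] *)
Definition posterior (R : realType) (A W : R) (T r : nat) (enc : encoder R r)
    (X0 : R * R) (x : nat -> R) (s : nat -> bool) (l : nat) : R * R :=
  update enc (s l) (mkseq s l) (prior A W T enc X0 x s l) (x (l * T)%N).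

(* The estimate of x (l * T + dl), where dl is the latency. *)
Definition estimate (R : realType) (A W : R) (T dl r : nat) (enc : encoder R r)
    (X0 : R * R) (x : nat -> R) (s : nat -> bool) (l : nat) : R :=
  A ^+ dl * midpoint (posterior A W T enc X0 x s l).

Definition est_error (R : realType) (A W : R) (T dl r : nat) (enc : encoder R r)
    (X0 : R * R) (x : nat -> R) (s : nat -> bool) (l : nat) : R :=
  `| x (l * T + dl)%N - estimate A W T dl enc X0 x s l |.

Definition mutually_independent (disp : measure_display)
    (Omega : measurableType disp) (R : realType) (P : probability Omega R)
    (F : nat -> set Omega) : Prop :=
  forall J : seq nat, uniq J ->
    P (\big[setI/setT]_(j <- J) F j) = (\prod_(j <- J) P (F j))%E.

(* F l is the event that message l is corrupted. *)
Definition bounded_expected_error (disp : measure_display)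
    (Omega : measurableType disp) (R : realType) (P : probability Omega R)
    (F : nat -> set Omega) (A W : R) (T dl r : nat) (enc : encoder R r)
    (X0 : R * R) : Prop :=
  exists C : R, forall (l : nat) (x0 : R) (w : nat -> R),
    in_segment X0 x0 ->
    (forall k : nat, in_segment (- (W / 2), W / 2) (w k)) ->
    ('E_P[fun omega : Omega =>
        est_error A W T dl enc X0 (state A x0 w)
          (fun j : nat => omega \notin F j) l] <= C%:E)%E.

(* Main.v *)
Require Import Defs.
From HB Require Import structures.
From mathcomp Require Import all_boot all_order all_algebra.
From mathcomp Require Import all_classical all_reals all_analysis.
From mathcomp Require Import measurable_realfun ring lra.

Import Order.TTheory GRing.Theory Num.Theory.

Local Open Scope classical_set_scope.
Local Open Scope ring_scope.

(* The width D_l of [L_l, U_l] depends on the decoding outcomes alone, and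
   D_(l+1) = A^T D_l q_l + W (A^T - 1) / (A - 1) with q_l = 1 on failure and
   q_l = 2^-r on success. As q_l is independent of D_l, E D_l satisfies an affine
   recursion with ratio rho = (p_e + (1 - p_e) / 2^r) A^T, hence is bounded if
   rho < 1 and grows at least linearly if rho >= 1. The state never leaves the
   interval, so the error is at most A^d D_l / 2 plus a constant. Conversely,
   starting at the upper endpoint and applying the constant disturbance W/2
   keeps the state at the upper endpoint of every interval, whatever the outcomes
   are, so that the error is at least A^d D_l / (2 * 2^r) along this single
   trajectory. *)

(** * Evolution of the state over several steps *)

Section SystemDynamics.
Context {R : realType}.
Implicit Types (A W : R) (w : nat -> R) (m k : nat).

Lemma geom_sum0 A : geom_sum A 0 = 0.
Proof. exact: big_ord0. Qed.

Lemma geom_sumS A m : geom_sum A m.+1 = A * geom_sum A m + 1.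
Proof.
rewrite /geom_sum big_ord_recl expr0 addrC mulr_sumr; congr (_ + _).
by apply: eq_bigr => i _; rewrite exprS.
Qed.

Lemma geom_sum_ge0 A m : 0 <= A -> 0 <= geom_sum A m.
Proof. by move=> A0; apply: sumr_ge0 => i _; exact: exprn_ge0. Qed.

Lemma geom_sum_gt0 A m : 0 <= A -> (0 < m)%N -> 0 < geom_sum A m.
Proof.
case: m => // m A0 _; rewrite geom_sumS.
by rewrite ltr_wpDl// mulr_ge0// geom_sum_ge0.
Qed.

(** Each step multiplies the deviation by [A] and adds at most [W / 2], which is the recursion of
    [geom_sum]. Used with [m = T] for the intervals and [m = dl] for the latency. *)
Lemma state_dist A W (x0 : R) w k m : 0 <= A ->
  (forall j, in_segment (- (W / 2), W / 2) (w j)) ->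
  `|state A x0 w (k + m) - A ^+ m * state A x0 w k| <= geom_sum A m * (W / 2).
Proof.
move=> A0 hw; elim: m => [|m IH].
  by rewrite addn0 expr0 mul1r subrr normr0 geom_sum0 mul0r.
rewrite addnS /= geom_sumS exprS.
have /andP[/= w1 w2] := hw (k + m)%N.
move: IH; rewrite !ler_norml => /andP[/(ler_wpM2l A0) h1 /(ler_wpM2l A0) h2].
by apply/andP; split; lra.
Qed.

(** The extremal disturbance attains the bound of [state_dist]. *)
Lemma state_max A W (x0 : R) k m :
  state A x0 (fun=> W / 2) (k + m) =
  A ^+ m * state A x0 (fun=> W / 2) k + geom_sum A m * (W / 2).
Proof.
elim: m => [|m IH]; first by rewrite addn0 expr0 mul1r geom_sum0 mul0r addr0.
by rewrite addnS /= IH geom_sumS exprS; ring.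
Qed.

End SystemDynamics.

Definition width {R : realType} (I : R * R) : R := I.2 - I.1.

(** * Intervals and estimation error along one trajectory *)

Section Quantizer.
Context {R : realType} {r : nat}.
Implicit Types (I : R * R) (x : R) (s : nat -> bool) (b : bool) (h : seq bool).

Lemma width_ge0 I x : in_segment I x -> 0 <= width I.
Proof. by move=> /andP[h1 h2]; rewrite subr_ge0 (le_trans h1). Qed.

Lemma width_bin I (i : 'I_(2 ^ r)) : width (bin I i) = width I / 2 ^+ r.
Proof. by rewrite /width /bin /= -natr1; ring. Qed.

Lemma pow2_itv : 0 < (2 ^+ r : R)^-1 <= 1.
Proof. by rewrite invr_gt0 exprn_gt0//= invf_le1 ?exprn_gt0// exprn_ege1// ler1n. Qed.

(* The upper endpoint of the interval only belongs to the last bin, unless the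
   interval is a point. *)
Lemma bin_upper I (i : 'I_(2 ^ r)) :
  in_segment (bin I i) I.2 -> (bin I i).2 = I.2.
Proof.
move=> hI; have w0 := width_ge0 _ _ hI; move: hI => /andP[_ /= hI].
apply/eqP; rewrite eq_le hI andbT.
move: w0; rewrite width_bin /width; set q := (I.2 - I.1) / 2 ^+ r => q0.
have qE : I.2 = I.1 + (2 ^ r)%:R * q.
  by rewrite natrX /q mulrCA divff ?expf_neq0 ?pnatr_eq0// mulr1; ring.
by rewrite [leRHS]qE lerD2l ler_wpM2r// ler_nat.
Qed.

Variable enc : encoder R r.
Hypothesis henc : valid_encoder enc.

Lemma in_update b h I x : in_segment I x -> in_segment (update enc b h I x) x.
Proof. by case: b => //=; exact: henc. Qed.

(** All bins have equal length, so the choice made by [enc] cannot affect the width. *)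
Lemma width_update b h I x :
  width (update enc b h I x) = width I * (if b then (2 ^+ r)^-1 else 1).
Proof. by case: b => /=; rewrite ?width_bin ?mulr1. Qed.

Lemma update_upper b h I : I.1 <= I.2 -> (update enc b h I I.2).2 = I.2.
Proof.
by case: b => //= h12; apply: bin_upper; apply: henc; rewrite /in_segment h12/=.
Qed.

Lemma width_update_bounds b h I x : 0 <= width I ->
  width I / 2 ^+ r <= width (update enc b h I x) <= width I.
Proof.
move=> w0; rewrite width_update; have /andP[i0 i1] := pow2_itv.
by case: b; rewrite ?mulr1 lexx ?andbT ler_piMr.
Qed.

Variables (A W : R) (T : nat) (X0 : R * R).
Hypotheses (A0 : 0 <= A) (W0 : 0 <= W).

Lemma width_predict I :
  width (predict A W T I) = A ^+ T * width I + geom_sum A T * W.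
Proof. by rewrite /width /=; field. Qed.

(** The margin added by [predict] is the bound of [state_dist] over one period. *)
Lemma in_prior (x0 : R) w s l : in_segment X0 x0 ->
  (forall k, in_segment (- (W / 2), W / 2) (w k)) ->
  in_segment (prior A W T enc X0 (state A x0 w) s l) (state A x0 w (l * T)).
Proof.
move=> hx hw; elim: l => [|l IH]; first by rewrite mul0n.
rewrite mulSn addnC /= /in_segment /=.
move: (state_dist A W x0 w (l * T) T A0 hw).
have AT0 : 0 <= A ^+ T by exact: exprn_ge0.
have /andP[/(ler_wpM2l AT0) h1 /(ler_wpM2l AT0) h2] :=
  in_update (s l) (mkseq s l) _ _ IH.
by rewrite ler_norml => /andP[h3 h4]; apply/andP; split; lra.
Qed.

Lemma width_prior_ge0 (x0 : R) w s l : 0 <= width X0 ->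
  0 <= width (prior A W T enc X0 (state A x0 w) s l).
Proof.
move=> X00; elim: l => //= l IH.
rewrite width_predict width_update addr_ge0 ?mulr_ge0 ?exprn_ge0 ?geom_sum_ge0//.
by case: (s l) => //; case/andP: pow2_itv => /ltW.
Qed.

(** The state is within half a posterior width of the midpoint; the latency scales this by [A ^+ dl]
    and adds the disturbance of [dl] steps. *)
Lemma est_error_le dl (x0 : R) w s l : in_segment X0 x0 ->
  (forall k, in_segment (- (W / 2), W / 2) (w k)) ->
  est_error A W T dl enc X0 (state A x0 w) s l <=
  A ^+ dl / 2 * width (prior A W T enc X0 (state A x0 w) s l) +
    geom_sum A dl * (W / 2).
Proof.
move=> hx hw; have hp := in_prior _ _ s l hx hw.
move: (state_dist A W x0 w (l * T) dl A0 hw).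
have Ad0 : 0 <= A ^+ dl by exact: exprn_ge0.
have := in_update (s l) (mkseq s l) _ _ hp.
have /andP[_] := width_update_bounds (s l) (mkseq s l) _ (state A x0 w (l * T))
  (width_ge0 _ _ hp).
rewrite /est_error /estimate /posterior /midpoint.
set p := prior _ _ _ _ _ _ _ _; set I := update _ _ _ _ _.
set x := state _ _ _ (l * T); rewrite /width.
move=> hI /andP[h1 h2].
have := ler_wpM2l Ad0 hI; have := ler_wpM2l Ad0 h1; have := ler_wpM2l Ad0 h2.
rewrite !ler_norml => h3 h4 h5 /andP[h6 h7].
by apply/andP; split; lra.
Qed.

(** An update keeps the upper endpoint whenever the sample sits there, and [predict] then moves it
    exactly as the extremal disturbance moves the state. *)
Lemma state_max_prior s l : X0.1 <= X0.2 ->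
  state A X0.2 (fun=> W / 2) (l * T) =
  (prior A W T enc X0 (state A X0.2 (fun=> W / 2)) s l).2.
Proof.
move=> X00; elim: l => [|l IH]; first by rewrite mul0n.
rewrite mulSn addnC state_max /= IH update_upper//.
by rewrite -subr_ge0 width_prior_ge0// /width subr_ge0.
Qed.

Lemma est_error_max_ge dl s l : X0.1 <= X0.2 ->
  A ^+ dl / 2 / 2 ^+ r *
    width (prior A W T enc X0 (state A X0.2 (fun=> W / 2)) s l) <=
  est_error A W T dl enc X0 (state A X0.2 (fun=> W / 2)) s l.
Proof.
move=> X00; rewrite /est_error /estimate /posterior state_max.
rewrite (state_max_prior s)//.
have Ad0 : 0 <= A ^+ dl by exact: exprn_ge0.
have w0 : 0 <= width (prior A W T enc X0 (state A X0.2 (fun=> W / 2)) s l).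
  by rewrite width_prior_ge0// subr_ge0.
move: w0; set p := prior _ _ _ _ _ _ _ _ => w0.
have /andP[/(ler_wpM2l Ad0)] :=
  width_update_bounds (s l) (mkseq s l) p p.2 w0.
have p12 : p.1 <= p.2 by rewrite -subr_ge0.
have := update_upper (s l) (mkseq s l) p p12.
have g0 : 0 <= geom_sum A dl * (W / 2).
  by rewrite mulr_ge0 ?geom_sum_ge0 ?divr_ge0.
rewrite /midpoint; set I := update _ _ _ _ _; rewrite {2}/width => -> h1 h2.
(* With the state at the upper endpoint, the half width and the disturbance term are both
   nonnegative and cannot cancel. *)
by apply: le_trans (ler_norm _); lra.
Qed.

End Quantizer.

(** * Widths as a process driven by the decoding outcomes *)

Fixpoint width_process {R : realType} (A W : R) (T r : nat) (d0 : R)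
    (s : nat -> bool) (l : nat) : R :=
  if l is k.+1 then
    A ^+ T * (width_process A W T r d0 s k * (if s k then (2 ^+ r)^-1 else 1)) +
      geom_sum A T * W
  else d0.

(** Eliminates the encoder and the trajectory, leaving a quantity that is measurable whatever the
    encoder is. *)
Lemma width_prior {R : realType} (A W : R) (T r : nat) (enc : encoder R r)
    (X0 : R * R) (x : nat -> R) (s : nat -> bool) (l : nat) :
  width (prior A W T enc X0 x s l) = width_process A W T r (width X0) s l.
Proof. by elim: l => //= l IH; rewrite width_predict width_update IH. Qed.

Lemma width_process_ge0 {R : realType} (A W : R) (T r : nat) (d0 : R)
    (s : nat -> bool) (l : nat) : 0 <= A -> 0 <= W -> 0 <= d0 ->
  0 <= width_process A W T r d0 s l.
Proof.
move=> A0 W0 d00; elim: l => //= l IH.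
rewrite addr_ge0 ?mulr_ge0 ?exprn_ge0 ?geom_sum_ge0//.
by case: (s l); rewrite ?ler01// invr_ge0 exprn_ge0.
Qed.

(* Unlike [ge0_le_integral], this asks for no measurability: the estimation
   error depends on an arbitrary encoder. *)
Lemma ge0_le_integralT {d} {T : measurableType d} {R : realType}
    (mu : {measure set T -> \bar R}) (f g : T -> \bar R) :
  (forall x, 0 <= f x)%E -> (forall x, f x <= g x)%E ->
  (\int[mu]_x f x <= \int[mu]_x g x)%E.
Proof.
move=> f0 fg; rewrite !ge0_integralTE//; last first.
  by move=> x; exact: le_trans (fg x).
apply: le_ereal_sup => _ [h /= hf <-]; exists h => //= x.
exact: le_trans (fg x).
Qed.

(** * Expected width and its growth *)

Section ExpectedWidth.
Context {R : realType} {disp : measure_display} {Omega : measurableType disp}.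
Variables (P : probability Omega R) (F : nat -> set Omega) (pe : R).
Hypothesis hFmeas : forall l, measurable (F l).
Hypothesis hFprob : forall l, P (F l) = pe%:E.
Hypothesis hFind : mutually_independent P F.
Variables (A W : R) (T r : nat) (d0 : R).
Hypotheses (A0 : 0 <= A) (W0 : 0 <= W) (d00 : 0 <= d0).

Let D (l : nat) (omega : Omega) : R :=
  width_process A W T r d0 (fun j => omega \notin F j) l.

Let rho := (pe + (1 - pe) / 2 ^+ r) * A ^+ T.

Fixpoint mean_width (l : nat) : R :=
  if l is k.+1 then rho * mean_width k + geom_sum A T * W else d0.

Let D_ge0 l omega : 0 <= D l omega.
Proof. exact: width_process_ge0. Qed.

Let beta : R := (2 ^+ r)^-1.

Let beta_ge0 : 0 <= beta. Proof. by rewrite invr_ge0 exprn_ge0. Qed.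

Let beta_le1 : 0 <= 1 - beta.
Proof. by rewrite subr_ge0; have /andP[] := @pow2_itv R r. Qed.

(** Writing the random factor as [beta + (1 - beta) * \1_(F l)] gives a sum with nonnegative
    coefficients, which can be integrated term by term. *)
Let DS l omega : D l.+1 omega =
  A ^+ T * (1 - beta) * (D l omega * \1_(F l) omega) +
  A ^+ T * beta * D l omega + geom_sum A T * W.
Proof.
rewrite /D /= -/(D l omega) indicE.
by case: (omega \in F l) => /=; rewrite -/beta; ring.
Qed.

Lemma measurable_width_process l : measurable_fun setT (D l).
Proof.
elim: l => [|l IH]; first exact: measurable_cst.
rewrite (_ : D l.+1 = fun omega =>
  A ^+ T * (1 - beta) * (D l omega * \1_(F l) omega) +
  A ^+ T * beta * D l omega + geom_sum A T * W); last exact/funext/DS.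
apply: measurable_funD; last exact: measurable_cst.
apply: measurable_funD; last by apply: measurable_funM.
apply: measurable_funM => //; apply: measurable_funM => //.
Qed.

Let FJ (J : seq nat) := \big[setI/setT]_(j <- J) F j.

Let mFJ J : measurable (FJ J).
Proof. by apply: bigsetI_measurable. Qed.

(* Generalized over the failure events of the messages not sent yet, so that
   independence can be used in the induction on [l]. *)
Lemma integral_width_process l (J : seq nat) : uniq J -> all (leq l) J ->
  (\int[P]_(x in FJ J) (D l x)%:E = (mean_width l * pe ^+ size J)%:E)%E.
Proof.
have intJ (c : R) K : uniq K ->
    (\int[P]_(x in FJ K) c%:E = (c * pe ^+ size K)%:E)%E.
  move=> uK; have -> : (\int[P]_(x in FJ K) c%:E = c%:E * P (FJ K))%E.
    exact: integral_cst.
  rewrite hFind// EFinM; congr (_ * _)%E.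
  elim: K {uK} => [|k K IH]; first by rewrite big_nil.
  by rewrite big_cons IH hFprob -EFinM exprS.
elim: l J => [|l IH] J uJ lJ.
  exact: intJ.
have lnJ : l \notin J.
  by apply/negP => /(allP lJ); rewrite ltnn.
have lJ' : all (leq l) J by apply: sub_all lJ => j /ltnW.
have mD := measurable_width_process l.
have mE : measurable_fun (FJ J) (fun x => (D l x)%:E).
  by apply/measurable_EFinP; exact: measurable_funS mD.
have mE1 : measurable_fun (FJ J) (fun x => (D l x * \1_(F l) x)%:E).
  apply/measurable_EFinP; apply: (@measurable_funS _ _ _ _ setT) => //.
  by apply: measurable_funM => //; exact: measurable_indic.
have i0 x : 0 <= \1_(F l) x :> R by rewrite indicE.
(* The indicator is absorbed into the domain: the induction hypothesis is applied to [l :: J], which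
   yields the additional factor [pe]. *)
have E1 : (\int[P]_(x in FJ J) (D l x * \1_(F l) x)%:E =
    (mean_width l * pe ^+ (size J).+1)%:E)%E.
  rewrite -[(size J).+1]/(size (l :: J)) -IH; last 2 first.
  - by rewrite /= lnJ.
  - by rewrite /= leqnn.
  rewrite /FJ big_cons setIC integral_mkcondr; apply: eq_integral => x _.
  by rewrite /patch indicE; case: ifPn; rewrite ?mulr1 ?mulr0.
under eq_integral do rewrite DS !EFinD.
rewrite ge0_integralD//; last 3 first.
- by move=> x _; rewrite -EFinD lee_fin addr_ge0 ?mulr_ge0 ?exprn_ge0.
- by apply: emeasurable_funD; under eq_fun do rewrite EFinM;
    exact: measurable_funeM.
- by move=> x _; rewrite lee_fin mulr_ge0 ?geom_sum_ge0.
rewrite ge0_integralD//; last 4 first.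
- by move=> x _; rewrite lee_fin ?mulr_ge0 ?exprn_ge0.
- by under eq_fun do rewrite EFinM; exact: measurable_funeM.
- by move=> x _; rewrite lee_fin ?mulr_ge0 ?exprn_ge0.
- by under eq_fun do rewrite EFinM; exact: measurable_funeM.
under eq_integral do rewrite EFinM.
rewrite ge0_integralZl_EFin//; last 2 first.
- by move=> x _; rewrite lee_fin ?mulr_ge0.
- by rewrite mulr_ge0// exprn_ge0.
under [X in (_ + X + _)%E]eq_integral do rewrite EFinM.
rewrite ge0_integralZl_EFin//; last 2 first.
- by move=> x _; rewrite lee_fin.
- by rewrite mulr_ge0// exprn_ge0.
rewrite intJ// E1 IH// -!EFinM -!EFinD.
(* The ratio appears as [(1 - beta) * pe + beta = pe + (1 - pe) * beta]. *)
by congr EFin; rewrite /= /rho -/beta exprS; ring.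
Qed.

Lemma expected_width_process l : (\int[P]_x (D l x)%:E = (mean_width l)%:E)%E.
Proof.
by have := integral_width_process l [::] isT isT; rewrite /FJ big_nil mulr1.
Qed.

Lemma integral_affine_width_process l (a c : R) : 0 <= a -> 0 <= c ->
  (\int[P]_x (a * D l x + c)%:E = (a * mean_width l + c)%:E)%E.
Proof.
move=> a0 c0; have mD := measurable_width_process l.
have mE : measurable_fun setT (fun x => (D l x)%:E) by exact/measurable_EFinP.
under eq_integral do rewrite EFinD EFinM.
rewrite ge0_integralD//; last 2 first.
- by move=> x _; rewrite -EFinM lee_fin mulr_ge0.
- exact: measurable_funeM.
rewrite ge0_integralZl_EFin//; last by move=> x _; rewrite lee_fin.
rewrite expected_width_process (integral_cst P measurableT c%:E).
by rewrite [X in (_ + _ * X)%E]probability_setT mule1.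
Qed.

Lemma mean_width_le l : 0 <= rho < 1 ->
  mean_width l <= d0 + geom_sum A T * W / (1 - rho).
Proof.
move=> /andP[r0 r1]; have q0 : 0 < 1 - rho by rewrite subr_gt0.
set g := geom_sum A T * W.
have g0 : 0 <= g by rewrite mulr_ge0// geom_sum_ge0.
(* The fixed point of the affine recursion. *)
set b := g / (1 - rho).
have b0 : 0 <= b by rewrite divr_ge0// ltW.
have gE : g = b - rho * b by rewrite /b; field; rewrite gt_eqF.
elim: l => [|l /(ler_wpM2l r0) IH] /=; first by rewrite lerDl.
have d1 : rho * d0 <= d0 by rewrite ler_piMl// ltW.
rewrite -/g; lra.
Qed.

(** For [rho >= 1] the mean never shrinks, and each period adds [geom_sum A T * W]. *)
Lemma mean_width_ge l : 1 <= rho -> geom_sum A T * W * l%:R <= mean_width l.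
Proof.
move=> r1; have g0 : 0 <= geom_sum A T * W by rewrite mulr_ge0// geom_sum_ge0.
elim: l => [|l IH] /=; first by rewrite mulr0.
rewrite -natr1 mulrDr mulr1 lerD2r (le_trans IH)// ler_peMl//.
by apply: le_trans IH; rewrite mulr_ge0.
Qed.

End ExpectedWidth.

(** * From the expected width to the expected error *)

Theorem theorem1 (R : realType) (disp : measure_display)
    (Omega : measurableType disp) (P : probability Omega R)
    (A W Xlo Xhi pe : R) (T r dl : nat)
    (enc : encoder R r) (F : nat -> set Omega)
    (hA : 0 <= A) (hW : 0 < W) (hX : Xlo <= Xhi)
    (hT : (1 <= T)%N) (hr : (1 <= r)%N) (hdl : (dl <= T)%N)
    (hpe : 0 <= pe <= 1)
    (henc : valid_encoder enc)
    (hFmeas : forall l : nat, measurable (F l))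
    (hFprob : forall l : nat, P (F l) = pe%:E)
    (hFind : mutually_independent P F) :
  bounded_expected_error P F A W T dl enc (Xlo, Xhi) <->
  (pe + (1 - pe) / 2 ^+ r) * A ^+ T < 1.
Proof.
have /andP[pe0 pe1] := hpe.
have W0 := ltW hW.
have X00 : 0 <= width (Xlo, Xhi) by rewrite subr_ge0.
set rho := (_ * A ^+ T).
have rho0 : 0 <= rho.
  by rewrite mulr_ge0 ?exprn_ge0// addr_ge0// divr_ge0 ?exprn_ge0// subr_ge0.
have EW l a c := integral_affine_width_process P F pe hFmeas hFprob hFind
  A W T r (width (Xlo, Xhi)) hA W0 X00 l a c.
split=> [[C hC]|rho1].
  rewrite ltNge; apply/negP => rho1.
  (* Since [T >= 1], [A = 0] would give [rho = 0]. *)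
  have A_gt0 : 0 < A.
    rewrite lt_neqAle hA andbT eq_sym; apply/eqP => A_eq0.
    by move: rho1; rewrite /rho A_eq0 expr0n gtn_eqF// mulr0 ler10.
  set a := A ^+ dl / 2 / 2 ^+ r.
  have a0 : 0 < a by rewrite !divr_gt0 ?exprn_gt0.
  set g := geom_sum A T * W.
  have g0 : 0 < g by rewrite mulr_gt0 ?geom_sum_gt0.
  (* The hypothesis is used only on the extremal trajectory from [Xhi]. *)
  have aC l : a * (g * l%:R) <= C.
    rewrite -lee_fin; apply: le_trans (hC l Xhi (fun=> W / 2) _ _); last 2 first.
    - by rewrite /in_segment /= hX lexx.
    - by move=> k; rewrite /in_segment /= lexx andbT; lra.
    apply: (@le_trans _ _ (a * mean_width pe A W T r (width (Xlo, Xhi)) l + 0)%:E).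
      rewrite addr0 lee_fin ler_wpM2l ?(ltW a0)//.
      exact: mean_width_ge.
    rewrite -EW ?(ltW a0)// unlock; apply: ge0_le_integralT => omega.
      by rewrite lee_fin addr0 mulr_ge0 ?(ltW a0)// width_process_ge0.
    rewrite lee_fin addr0 -(width_prior _ _ _ _ enc _ (state A Xhi (fun=> W / 2))).
    exact: (est_error_max_ge enc henc A W T (Xlo, Xhi)).
  have ag0 : 0 < a * g by rewrite mulr_gt0.
  (* An index exceeding [C / (a * g)] contradicts the bound. *)
  have := aC (Num.truncn (C / (a * g))).+1.
  rewrite mulrA leNgt => /negP; apply.
  rewrite mulrC -ltr_pdivrMr//; exact: truncnS_gt.
(* The bound of [mean_width_le] inserted into that of [est_error_le]. *)
exists (A ^+ dl / 2 * (width (Xlo, Xhi) + geom_sum A T * W / (1 - rho)) +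
    geom_sum A dl * (W / 2)) => l x0 w hx hw.
have a0 : 0 <= A ^+ dl / 2 by rewrite divr_ge0 ?exprn_ge0.
have c0 : 0 <= geom_sum A dl * (W / 2).
  by rewrite mulr_ge0 ?geom_sum_ge0 ?divr_ge0.
apply: (@le_trans _ _ (A ^+ dl / 2 *
    mean_width pe A W T r (width (Xlo, Xhi)) l + geom_sum A dl * (W / 2))%:E).
  rewrite -EW// unlock; apply: ge0_le_integralT => omega.
    by rewrite lee_fin normr_ge0.
  rewrite lee_fin -(width_prior _ _ _ _ enc _ (state A x0 w)).
  exact: est_error_le.
rewrite lee_fin lerD2r ler_wpM2l//; apply: mean_width_le => //.
by rewrite -/rho rho0.
Qed.
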